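(* Let $n\geq 1$ and $p\in(0,1)$. For any non-decreasing boolean function $f:\{0,1\}^n\to\{0,1\}$, we have $$\sum_{1\leq i\leq n}\Big(P\big(i\text{ is pivotal for }f\big)\Big)^2\,\leq\,\frac{E(f)}{p(1-p)}\,.$$
   Context: Let $\Omega=\{0,1\}^n$, with elements $\omega=(\omega(1),\dots,\omega(n))$. The probability $P$ on $\Omega$ is the Bernoulli product measure of parameter $p$: $P(\omega)=\prod_{1\leq i\leq n}p^{\omega(i)}(1-p)^{1-\omega(i)}$, and $E$ is the expectation with respect to $P$, so $E(f)=\sum_{\omega\in\Omega}f(\omega)P(\omega)$. For $\omega\in\Omega$ and $i\in\{1,\dots,n\}$, $\omega^i$ (respectively $\omega_i$) denotes the configuration equal to $\omega$ except that its $i$-th component is set to $1$ (respectively to $0$). A boolean function is a function $f:\Omega\to\{0,1\}$; it is non-decreasing if $f(\omega_i)\leq f(\omega^i)$ for all $\omega\in\Omega$ and all $i\in\{1,\dots,n\}$. The coordinate $i$ is pivotal for $f$ in $\omega$ if $f(\omega^i)\neq f(\omega_i)$; $P(i\text{ is pivotal for }f)$ is the $P$-probability of the set of those $\omega\in\Omega$ in which $i$ is pivotal for $f$. *)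

(* Defs.v *)
From mathcomp Require Import all_boot all_order all_algebra.

Set Implicit Arguments.
Unset Strict Implicit.
Unset Printing Implicit Defensive.

Import Order.TTheory GRing.Theory Num.Theory.

Local Open Scope ring_scope.

(* The value set {0,1} is represented by [bool], with the standard coercion
   to [nat] (false = 0, true = 1); indices range over 0, ..., n-1. *)
Definition Omega (n : nat) : finType := {ffun 'I_n -> bool}.

Definition boolean_function (n : nat) := Omega n -> bool.

Definition set_coord (n : nat) (w : Omega n) (i : 'I_n) (b : bool) : Omega n :=
  [ffun j => if j == i then b else w j].

(* omega^i *)
Definition up (n : nat) (w : Omega n) (i : 'I_n) : Omega n :=
  set_coord w i true.

(* omega_i *)
Definition down (n : nat) (w : Omega n) (i : 'I_n) : Omega n :=
  set_coord w i false.

Definition nondecreasing_bf (n : nat) (f : boolean_function n) : Prop :=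
  forall (w : Omega n) (i : 'I_n), (f (down w i) <= f (up w i))%N.

Definition pivotal (n : nat) (f : boolean_function n) (i : 'I_n)
    (w : Omega n) : bool :=
  f (up w i) != f (down w i).

Definition bernoulli_mass (R : realFieldType) (n : nat) (p : R)
    (w : Omega n) : R :=
  \prod_(i < n) (p ^+ w i * (1 - p) ^+ (1 - w i)%N).

Definition Pr (R : realFieldType) (n : nat) (p : R) (A : {set Omega n}) : R :=
  \sum_(w in A) bernoulli_mass p w.

Definition expect (R : realFieldType) (n : nat) (p : R)
    (g : Omega n -> R) : R :=
  \sum_w g w * bernoulli_mass p w.

(* Main.v *)
Require Import Defs.
From mathcomp Require Import all_boot all_order all_algebra.
From mathcomp Require Import ring.

Set Implicit Arguments.
Unset Strict Implicit.
Unset Printing Implicit Defensive.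

Import Order.TTheory GRing.Theory Num.Theory.

Local Open Scope ring_scope.

(** Bessel's inequality: the centered coordinates [w i - p] are orthogonal in
    L^2(P), each of squared norm [p * (1 - p)]. Averaging over the [i]-th
    coordinate shows that, for a nondecreasing [f], the inner product of [f]
    with the [i]-th one is [p * (1 - p) * P(i is pivotal)], whereas the squared
    norm of [f] is [E(f)] because [f] takes the values 0 and 1. *)

Section SetCoord.
Variable n : nat.
Implicit Types (w : Omega n) (i j : 'I_n).

Lemma set_coord_eq w i b : set_coord w i b i = b.
Proof. by rewrite ffunE eqxx. Qed.

Lemma set_coord_neq w i j b : j != i -> set_coord w i b j = w j.
Proof. by rewrite ffunE => /negbTE ->. Qed.

Lemma set_coordK w i b c : set_coord (set_coord w i b) i c = set_coord w i c.
Proof. by apply/ffunP => j; rewrite !ffunE; case: eqP. Qed.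

Lemma set_coord_id w i b : w i = b -> set_coord w i b = w.
Proof. by move=> wi; apply/ffunP => j; rewrite ffunE; case: eqP => [->|]. Qed.

(** Configurations that differ only at [i] are paired, each pair being indexed by its member that
    vanishes at [i]. *)
Lemma sum_up_down (V : nmodType) (i : 'I_n) (h : Omega n -> V) :
  \sum_w h w = \sum_(w : Omega n | ~~ w i) (h (up w i) + h (down w i)).
Proof.
rewrite (bigID (fun w : Omega n => w i)) /= big_split /=; congr (_ + _); last first.
  by apply: eq_bigr => w /negbTE wi; rewrite /down set_coord_id.
rewrite (reindex_onto (fun w => up w i) (fun w => down w i)) /=.
  apply: eq_bigl => w; rewrite /up /down set_coord_eq set_coordK /=.
  apply/eqP/idP => [<-|/negbTE wi]; first by rewrite set_coord_eq.
  exact: set_coord_id.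
by move=> w wi; rewrite /up /down set_coordK set_coord_id.
Qed.

End SetCoord.

Section Expectation.
Variables (R : realFieldType) (n : nat) (p : R).
Implicit Types (g h : Omega n -> R) (i j : 'I_n).

Lemma eq_expect g h : g =1 h -> expect p g = expect p h.
Proof. by move=> gh; apply: eq_bigr => w _; rewrite gh. Qed.

Lemma expectD g h : expect p (fun w => g w + h w) = expect p g + expect p h.
Proof. by rewrite -big_split; apply: eq_bigr => w _; rewrite mulrDl. Qed.

Lemma expectZ c g : expect p (fun w => c * g w) = c * expect p g.
Proof. by rewrite mulr_sumr; apply: eq_bigr => w _; rewrite mulrA. Qed.

Lemma expect_sum (I : finType) (G : I -> Omega n -> R) :
  expect p (fun w => \sum_i G i w) = \sum_i expect p (G i).
Proof.
by rewrite exchange_big; apply: eq_bigr => w _; rewrite mulr_suml.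
Qed.

Lemma expect_cst c : expect p (fun _ : Omega n => c) = c.
Proof.
rewrite /expect -mulr_sumr.
(* Distributivity read backwards: the total mass becomes a product over the coordinates of the sums
   [p + (1 - p)], each equal to 1. *)
rewrite -(bigA_distr_bigA (fun _ (b : bool) => p ^+ b * (1 - p) ^+ (1 - b)%N)).
rewrite big1 ?mulr1 // => i _.
by rewrite big_bool /= !expr1 !expr0 mulr1 mul1r addrC subrK.
Qed.

Lemma expect_ge0 g : 0 <= p <= 1 -> (forall w, 0 <= g w) -> 0 <= expect p g.
Proof.
move=> /andP[p0 p1] g0; apply: sumr_ge0 => w _; apply: mulr_ge0 => //.
by apply: prodr_ge0 => i _; rewrite mulr_ge0 // exprn_ge0 // subr_ge0.
Qed.

Lemma Pr_expect (A : {set Omega n}) :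
  Pr p A = expect p (fun w => (w \in A)%:R).
Proof.
rewrite /Pr big_mkcond; apply: eq_bigr => w _.
by case: ifP => _; rewrite (mul1r, mul0r).
Qed.

Lemma bernoulli_mass_set_coord (w : Omega n) i b :
  bernoulli_mass p (set_coord w i b) =
  p ^+ b * (1 - p) ^+ (1 - b)%N *
    \prod_(j < n | j != i) (p ^+ w j * (1 - p) ^+ (1 - w j)%N).
Proof.
rewrite /bernoulli_mass (bigD1 i) //= set_coord_eq; congr (_ * _).
by apply: eq_bigr => j ji; rewrite set_coord_neq.
Qed.

(** Coordinate [i] is independent of the others. The two members of a pair have masses [p * m] and
    [(1 - p) * m] with the same [m], and the averaged integrand is constant on the pair. *)
Lemma expect_resample i g :
  expect p g = expect p (fun w => p * g (up w i) + (1 - p) * g (down w i)).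
Proof.
rewrite /expect !(sum_up_down i); apply: eq_bigr => w _.
rewrite /up /down !set_coordK !bernoulli_mass_set_coord /=.
rewrite !expr1 !expr0; ring.
Qed.

Definition centered i (w : Omega n) : R := (w i)%:R - p.

Lemma expect_centered_mul i j :
  expect p (fun w => centered i w * centered j w) =
  if i == j then p * (1 - p) else 0.
Proof.
rewrite (expect_resample i); case: eqVneq => [<-|ij].
  (* The average over coordinate [i] is the constant [p * (1 - p) ^+ 2 + (1 - p) * p ^+ 2 = p * (1 -
     p)]. *)
  rewrite -[RHS]expect_cst; apply: eq_expect => w.
  by rewrite /centered /up /down !set_coord_eq /=; ring.
(* The factor at [j] does not see coordinate [i], and the factor at [i] averages to
   [p * (1 - p) + (1 - p) * (- p) = 0]. *)
rewrite -[RHS]expect_cst; apply: eq_expect => w.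
rewrite /centered /up /down !set_coord_eq !set_coord_neq 1?eq_sym //=; ring.
Qed.

Lemma expect_mul_centered (f : boolean_function n) i :
  nondecreasing_bf f ->
  expect p (fun w => (f w)%:R * centered i w) =
  p * (1 - p) * Pr p [set w | pivotal f i w].
Proof.
move=> f_mono; rewrite (expect_resample i) Pr_expect -expectZ.
apply: eq_expect => w; rewrite /centered inE /pivotal.
have := f_mono w i; rewrite {3 4}/up {3 4}/down !set_coord_eq.
(* The average is [p * (1 - p)] times [f (up w i) - f (down w i)]. Monotonicity excludes the value
   -1, so this difference is the indicator of pivotality. *)
by case: (f (up w i)); case: (f (down w i)) => //= _; ring.
Qed.

End Expectation.

Theorem proposition6p1 (R : realFieldType) (n : nat) (p : R)
    (hn : (1 <= n)%N) (hp0 : 0 < p) (hp1 : p < 1)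
    (f : boolean_function n) (hf : nondecreasing_bf f) :
  \sum_(i < n) (Pr p [set w | pivotal f i w]) ^+ 2
    <= expect p (fun w => (f w)%:R) / (p * (1 - p)).
Proof.
have pq_gt0 : 0 < p * (1 - p) by rewrite mulr_gt0 // subr_gt0.
rewrite ler_pdivlMr //.
set a := fun i => Pr p [set w | pivotal f i w].
(* [S] is the orthogonal projection of [f] onto the span of the centered coordinates: the
   coefficient [p * (1 - p) * a i / (p * (1 - p))] is [a i]. *)
pose S w := \sum_i a i * centered p i w.
have ES2 : expect p (fun w => S w * S w) = (\sum_i a i ^+ 2) * (p * (1 - p)).
  under eq_expect do rewrite mulr_suml.
  rewrite expect_sum mulr_suml; apply: eq_bigr => i _.
  under eq_expect do rewrite mulr_sumr.
  (* Orthogonality leaves only the diagonal term. *)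
  rewrite expect_sum (bigD1 i) //= big1 => [|j ji].
    under eq_expect do rewrite mulrACA.
    by rewrite expectZ expect_centered_mul eqxx addr0.
  under eq_expect do rewrite mulrACA.
  by rewrite expectZ expect_centered_mul eq_sym (negbTE ji) mulr0.
have EfS : expect p (fun w => (f w)%:R * S w) = (\sum_i a i ^+ 2) * (p * (1 - p)).
  under eq_expect do rewrite mulr_sumr.
  rewrite expect_sum mulr_suml; apply: eq_bigr => i _.
  under eq_expect do rewrite mulrCA.
  by rewrite expectZ expect_mul_centered // -/(a i); ring.
rewrite -subr_ge0.
(* The squared distance from [f] to [S] equals [E(f) - E(S^2)], since [E(f S) = E(S^2)]. *)
have: 0 <= expect p (fun w => ((f w)%:R - S w) ^+ 2).
  by apply: expect_ge0 => [|w]; rewrite ?sqr_ge0 // !ltW.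
have -> : expect p (fun w => ((f w)%:R - S w) ^+ 2) =
    expect p (fun w => (f w)%:R) +
    ((- 2) * expect p (fun w => (f w)%:R * S w) + expect p (fun w => S w * S w)).
  rewrite -expectZ -!expectD; apply: eq_expect => w.
  (* The case split supplies [f^2 = f]. *)
  by case: (f w) => /=; ring.
by rewrite EfS ES2; congr (is_true (0 <= _)); ring.
Qed.
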